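(* Let $G$ be a connected graph and let $T$ be a spanning tree of $G$. Let $\mu_G(x)$ be the matching polynomial of $G$. Then there exists a partial orientation $\sigma$ of $G$ with respect to $T$ such that $\lambda_{\max}(G_T^\sigma) \le \rho(\mu_G)$.
   Context: Graphs are finite and simple. Let $G=(V,E)$ be a connected graph with spanning tree $T$. A partial orientation $\sigma$ of $G$ with respect to $T$ is an orientation of the edges in $E(G)\setminus E(T)$, the edges of $T$ being left undirected. Formally, to each ordered pair $(u,v)$ of vertices with $\{u,v\}\notin E(T)$ it assigns $\sigma(u,v)\in\{0,1,-1\}$ with $\sigma(u,v)=-\sigma(v,u)$ and $\sigma(u,v)\neq 0$ if and only if $\{u,v\}\in E(G)$; the edge $\{u,v\}\in E(G)\setminus E(T)$ is oriented from $u$ to $v$ if $\sigma(u,v)=1$ and from $v$ to $u$ if $\sigma(u,v)=-1$. The resulting mixed graph is denoted $G_T^\sigma$. Its Hermitian adjacency matrix is $H(G_T^\sigma)=(h_{uv})_{u,v\in V}$, where $h_{uv}=1$ if $\{u,v\}\in E(T)$, $h_{uv}=\mathbf{i}\,\sigma(u,v)$ if $\{u,v\}\in E(G)\setminus E(T)$, and $h_{uv}=0$ otherwise, with $\mathbf{i}=\sqrt{-1}$. This matrix is Hermitian, so its eigenvalues are real, and $\lambda_{\max}(G_T^\sigma)$ denotes its largest eigenvalue. For a graph $G$ of order $n$, the matching polynomial is $\mu_G(x)=\sum_{k\ge 0}(-1)^k m_k(G)x^{n-2k}$, where $m_k(G)$ is the number of matchings (sets of pairwise non-adjacent edges) of $G$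 with exactly $k$ edges and $m_0(G)=1$. $\rho(\mu_G)$ denotes the largest absolute value of the roots of $\mu_G(x)$. *)

(* Defs.v *)
From HB Require Import structures.
From mathcomp Require Import classical_sets reals.
From mathcomp Require Import all_boot all_order all_algebra.
From mathcomp Require Import complex.

Set Implicit Arguments.
Unset Strict Implicit.
Unset Printing Implicit Defensive.

Import Order.TTheory GRing.Theory Num.Theory.

Local Open Scope ring_scope.
Local Open Scope complex_scope.

Section Graphs.
Variable V : finType.
Implicit Types e G T : rel V.

Definition simple_graph e : Prop := symmetric e /\ irreflexive e.

(* The graph with no vertices does not count as connected. *)
Definition connected_graph e : Prop :=
  (0 < #|V|)%N /\ forall u v : V, connect e u v.

(* [ucycle] also accepts cycles of length at most 2, such as [:: u; v] for an
   edge uv, which are not cycles of the graph. *)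
Definition acyclic e : Prop := forall c : seq V, (2 < size c)%N -> ~ ucycle e c.

Definition tree e : Prop :=
  [/\ simple_graph e, connected_graph e & acyclic e].

Definition spanning_tree T G : Prop := tree T /\ subrel T G.

(* The values of sigma on the edges of T are irrelevant. *)
Definition partial_orientation G T (sigma : V -> V -> int) : Prop :=
  forall u v : V, ~~ T u v ->
    [/\ sigma u v \in [:: 0; 1; -1],
        sigma u v = - sigma v u
      & (sigma u v != 0) = G u v].

Definition edges G : {set {set V}} :=
  [set [set p.1; p.2] | p : V * V & G p.1 p.2].

Definition matchings G (k : nat) : {set {set {set V}}} :=
  [set M : {set {set V}} | [&& M \subset edges G, trivIset M & #|M| == k]].

(* A matching has at most #|V|./2 edges (see matchings_eq0), so that no term
   is missing and no exponent is truncated. *)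
Definition matching_poly (A : nzRingType) G : {poly A} :=
  \sum_(k < (#|V|./2).+1)
     ((-1) ^+ k * #|matchings G k|%:R) *: 'X^(#|V| - k.*2).

Definition hermitian_adj (R : realType) G T (sigma : V -> V -> int) :
    'M[R[i]]_#|V| :=
  \matrix_(i, j)
    let u := enum_val i in let v := enum_val j in
    if T u v then 1 else if G u v then 'i * (sigma u v)%:~R else 0.

End Graphs.

Section Spectrum.
Variable R : realType.

(* For a Hermitian matrix of positive size, all eigenvalues are real and this
   supremum is the largest one: see lambda_maxP. *)
Definition lambda_max n (A : 'M[R[i]]_n) : R :=
  sup [set x : R | eigenvalue A x%:C]%classic.

(* For a nonconstant p this is a maximum: see root_radiusP. The real part only
   retracts the norm, which is R[i]-valued, to R. *)
Definition root_radius (p : {poly R[i]}) : R :=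
  sup [set complex.Re `|z| | z in [set z : R[i] | root p z]]%classic.

End Spectrum.

Section SanityChecks.

Lemma card_edge (V : finType) (G : rel V) (a : {set V}) :
  simple_graph G -> a \in edges G -> #|a| = 2%N.
Proof.
move=> [_ irr] /imsetP[[u v] /=]; rewrite inE /= => Guv ->.
by rewrite cards2; case: eqP Guv => // ->; rewrite irr.
Qed.

Lemma matchings_eq0 (V : finType) (G : rel V) (k : nat) :
  simple_graph G -> (#|V|./2 < k)%N -> matchings G k = set0.
Proof.
move=> sG lt_k; apply/setP => M; rewrite !inE; apply/negP => /and3P[sM tM /eqP cM].
have : (#|cover M| <= #|V|)%N by exact: max_card.
rewrite -(eqP tM) (eq_bigr (fun=> 2%N)) => [|a aM]; last first.
  exact: card_edge sG (fintype.subsetP sM a aM).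
rewrite sum_nat_const cM muln2 => le_k.
by have := half_leq le_k; rewrite doubleK leqNgt lt_k.
Qed.

Lemma matchings0 (V : finType) (G : rel V) : matchings G 0 = [set set0].
Proof.
apply/setP => M; rewrite !inE cards_eq0; apply/idP/eqP => [/and3P[_ _ /eqP]//|->].
by rewrite sub0set eqxx andbT /trivIset /cover !big_set0 cards0 eqxx.
Qed.

Lemma size_matching_poly (V : finType) (G : rel V) (A : nzRingType) :
  size (matching_poly A G) = #|V|.+1.
Proof.
rewrite /matching_poly big_ord_recl /= matchings0 cards1 expr0 mulr1 scale1r.
rewrite subn0 size_polyDl size_polyXn //.
apply: (leq_ltn_trans (size_sum _ _ _)); rewrite ltnS.
apply/bigmax_leqP => i _; apply: leq_trans (size_scale_leq _ _) _.
rewrite size_polyXn /= /bump leq0n add1n.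
have : (0 < #|V|)%N by case: #|V| i => [[]|].
move=> V_gt0; apply: leq_ltn_trans (leq_sub2l _ _) _.
  by rewrite doubleS; apply: ltn0Sn.
by rewrite subn1 prednK.
Qed.

Variable R : realType.

Lemma finite_has_max (s : seq R) : s != [::] ->
  exists2 m, m \in s & forall x, x \in s -> x <= m.
Proof.
elim: s => // a [|b s] IHs _.
  by exists a; rewrite ?mem_head // => x; rewrite inE => /eqP ->.
have [m ms mmax] := IHs isT.
have [am|/ltW ma] := leP a m.
  exists m; first by rewrite inE ms orbT.
  by move=> x; rewrite inE => /predU1P[->//|]; apply: mmax.
exists a; first exact: mem_head.
by move=> x; rewrite inE => /predU1P[->//|/mmax]; move/le_trans; apply.
Qed.

Lemma sup_max (S : set R) (m : R) : S m -> (forall x, S x -> x <= m) -> sup S = m.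
Proof.
move=> Sm mub; apply/le_anti/andP; split.
  by apply: ge_sup => //; exists m.
by apply: ub_le_sup => //; exists m.
Qed.

Lemma root_radiusP (p : {poly R[i]}) : (1 < size p)%N ->
  (exists2 z, root p z & `|z| = (root_radius p)%:C) /\
  (forall z, root p z -> `|z| <= (root_radius p)%:C).
Proof.
move=> p1; have p0 : p != 0 by rewrite -size_poly_eq0 -lt0n ltnW.
have [r Dp] := closed_field_poly_normal p.
have rP z : root p z = (z \in r).
  by rewrite Dp rootZ ?lead_coef_eq0 // root_prod_XsubC.
have nRe (z : R[i]) : `|z| = (complex.Re `|z|)%:C by rewrite normc_def.
have [|m /mapP[z zr Dm] mmax] := @finite_has_max [seq complex.Re `|z| | z <- r].
  apply/negP => /eqP/(congr1 size); rewrite size_map => /size0nil r0.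
  by move: p1; rewrite Dp r0 big_nil -mul_polyC mulr1 size_polyC; case: eqP.
have -> : root_radius p = m.
  apply: sup_max; first by exists z; rewrite // /= rP.
  by move=> _ [y /= py <-]; apply: mmax; apply: map_f; rewrite -rP.
split; first by exists z; rewrite ?rP // Dm -nRe.
by move=> y; rewrite rP => yr; rewrite nRe lecR; apply/mmax/map_f.
Qed.

Lemma hermitian_eigenvalue_real n (A : 'M[R[i]]_n) (a : R[i]) :
  A^T = map_mx conjc A -> eigenvalue A a -> a = (complex.Re a)%:C.
Proof.
move=> hA /eigenvalueP[v Av v0].
pose w := (map_mx conjc v)^T; pose s := (v *m w) 0 0.
have Ds : s = \sum_j `|v 0 j| ^+ 2.
  by rewrite /s mxE; apply: eq_bigr => j _; rewrite !mxE sqr_normc.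
have s_neq0 : s != 0.
  rewrite Ds psumr_neq0 => [|j _]; last exact: exprn_ge0.
  have [j vj] : exists j, v 0 j != 0 by apply/rV0Pn.
  apply/hasP; exists j; rewrite ?mem_index_enum //=.
  by rewrite exprn_gt0 // normr_gt0.
have cM (x y : R[i]) : conjc (x * y) = conjc x * conjc y by exact: rmorphM.
have sJ : conjc s = s.
  rewrite Ds rmorph_sum; apply: eq_bigr => j _.
  by rewrite sqr_normc; apply: etrans (cM _ _) _; rewrite conjcK mulrC.
have Das : (v *m A *m w) 0 0 = a * s by rewrite Av -scalemxAl mxE.
have : conjc (a * s) = a * s.
  have cD p q r (B : 'M[R[i]]_(p, q)) (C : 'M[R[i]]_(q, r)) :
    map_mx conjc (B *m C) = map_mx conjc B *m map_mx conjc C.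
    exact: map_mxM.
  have Dw : v *m A *m w = (map_mx conjc (v *m A *m w))^T.
    rewrite !cD !trmx_mul mulmxA; congr (_ *m _ *m _).
    - by apply/matrixP => i j; rewrite !mxE conjcK.
    - by apply: etrans (esym (trmxK A)) _; congr _^T.
  by rewrite -Das [in RHS]Dw !mxE.
rewrite cM sJ => /(mulIf s_neq0).
by case: a {Av Das} => x y [] /eqP; rewrite eq_sym -subr_eq0 opprK -mulr2n mulrn_eq0 /= => /eqP ->.
Qed.

Lemma lambda_maxP n (A : 'M[R[i]]_n) : (0 < n)%N -> A^T = map_mx conjc A ->
  eigenvalue A (lambda_max A)%:C /\
  (forall z, eigenvalue A z -> z <= (lambda_max A)%:C).
Proof.
move=> n0 hA.
have [r Dp] := closed_field_poly_normal (char_poly A).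
have rP z : eigenvalue A z = (z \in r).
  rewrite eigenvalue_root_char Dp (monicP (char_poly_monic A)) scale1r.
  exact: root_prod_XsubC.
have [|m /mapP[z zr Dm] mmax] := @finite_has_max [seq complex.Re z | z <- r].
  apply/negP => /eqP/(congr1 size); rewrite size_map => /size0nil r0.
  have := size_char_poly A; rewrite Dp (monicP (char_poly_monic A)) r0 big_nil.
  by rewrite scale1r size_poly1; case: n n0 {A hA Dp rP}.
have zE : z = m%:C by rewrite Dm -(hermitian_eigenvalue_real hA) ?rP.
have -> : lambda_max A = m.
  apply: sup_max; first by rewrite /= -zE rP.
  by move=> x /=; rewrite rP => xr; apply/mmax/(map_f (@complex.Re R) xr).
rewrite -zE rP; split=> // y Ay.
rewrite (hermitian_eigenvalue_real hA Ay) zE lecR.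
by apply/mmax/map_f; rewrite -rP.
Qed.

Lemma hermitian_adj_hermitian (V : finType) (G T : rel V) sigma :
  simple_graph G -> spanning_tree T G -> partial_orientation G T sigma ->
  (hermitian_adj R G T sigma)^T = map_mx conjc (hermitian_adj R G T sigma).
Proof.
move=> [symG _] [[[symT _] _ _] _] os; apply/matrixP => i j; rewrite !mxE /=.
set u := enum_val i; set v := enum_val j.
rewrite symT symG; case: ifPn => [_|nT]; first by rewrite rmorph1.
case: ifP => _; last by rewrite rmorph0.
have [_ -> _] := os u v nT.
rewrite rmorphM /= rmorph_int rmorphN mulrN -mulNr.
by congr (_ * _); apply/eqP; rewrite eq_complex /= oppr0 opprK !eqxx.
Qed.

End SanityChecks.

(* Main.v *)
Require Import Defs.
From mathcomp Require Import boolp classical_sets topology normedtype derive realfun.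
From mathcomp Require Import all_boot all_order all_algebra.
From mathcomp Require Import complex reals.
From mathcomp Require Import polyrcf.
From mathcomp Require Import ring lra.

(** Give the tree edges weight 1, the other edges weight i or -i, and multiply
   each edge by an independent random sign.  The expected characteristic
   polynomial is the matching polynomial.  Averaging over the sign of one edge
   uv acts on [det (diag z - H)] as [1 - d/dz_u d/dz_v], and this operator
   preserves the absence of zeros with all [Im z_a > 0].  Hence, when all signs
   but that of uv are fixed or averaged, deleting u yields a polynomial q, the
   same for both signs of uv, such that f / q maps the upper half plane to
   itself for each of the two polynomials f.  So [f' q - f q' >= 0] on the real
   line and f / q increases to the right of the zeros of q; if the average of
   the two f is positive beyond c, so is one of them.  Fixing the signs one by
   one gives a signed Hermitian matrix with no eigenvalue above the largest
   root of the matching polynomial.  As T has no cycle, conjugating by a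
   diagonal matrix of signs then makes every tree entry equal to 1, while the
   other entries remain i or -i. *)

Set Implicit Arguments.
Unset Strict Implicit.
Unset Printing Implicit Defensive.

Import Order.TTheory GRing.Theory Num.Theory.
Import numFieldNormedType.Exports.

Local Open Scope ring_scope.

(** * Wronskians, monotone ratios and real roots of real polynomials *)

Section RealPoly.
Variable R : realType.
Implicit Types (f q p : {poly R}) (c x y : R).

Local Notation wronskian f q := (f^`() * q - f * q^`()).
Local Notation cpoly f := (map_poly (real_complex R) f).

(** Real and imaginary parts of [f] on a vertical line, as polynomials in [y]. Taking the factor [y]
    out of the imaginary part lets [wronskian_ge0] cancel it before [y] tends to 0. *)
Lemma horner_complex_split f x :
  exists a b : {poly R}, [/\ a.[0] = f.[x], b.[0] = f^`().[x] &
    forall y, (cpoly f).[Complex x y] = Complex a.[y] (y * b.[y])].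
Proof.
elim/poly_ind: f => [|f k [a [b [a0 b0 ab]]]].
  exists 0, 0; rewrite deriv0 !horner0; split=> // y.
  by rewrite rmorph0 !horner0 mulr0.
exists (x *: a - 'X^2 * b + k%:P), (x *: b + a); split=> [||y].
- by rewrite !hornerE a0 /= expr2 !mul0r subr0 mulrC.
- by rewrite derivD derivC derivM derivX !hornerE a0 b0 mulrC.
rewrite rmorphD rmorphM /= map_polyX map_polyC /= !hornerE ab /=.
apply/eqP; rewrite eq_complex /=; apply/andP; split; apply/eqP; ring.
Qed.

Lemma horner0_ge0 p : (forall y, 0 < y -> 0 <= p.[y]) -> 0 <= p.[0].
Proof.
move=> p_ge0; rewrite leNgt; apply/negP => p0_lt0.
have [|d d_gt0 pd] := poly_cont 0 p (e := - p.[0]); first by rewrite oppr_gt0.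
have d2 : 0 < d / 2 by rewrite divr_gt0.
have := pd (d / 2); rewrite subr0 gtr0_norm // ltr_pdivrMr // ltr_pMr //.
rewrite ltr1n => /(_ isT); have := p_ge0 _ d2.
by move=> h1; rewrite gtr0_norm; lra.
Qed.

(** On the vertical line through [x] the imaginary part of [f * conjc q] is [y] times a polynomial
    in [y] whose value at 0 is the Wronskian at [x]. *)
Lemma wronskian_ge0 f q :
  (forall z : R[i], 0 < complex.Im z ->
     0 <= complex.Im ((cpoly f).[z] * conjc (cpoly q).[z])) ->
  forall x, 0 <= (wronskian f q).[x].
Proof.
move=> fq x; have [a [b [a0 b0 ab]]] := horner_complex_split f x.
have [u [v [u0 v0 uv]]] := horner_complex_split q x.
have -> : (wronskian f q).[x] = (b * u - a * v).[0].
  by rewrite !hornerE a0 b0 u0 v0.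
apply: horner0_ge0 => y y_gt0; have := fq (Complex x y) y_gt0.
rewrite ab uv /= !hornerE => h; rewrite -(pmulr_rge0 _ y_gt0).
by apply: le_trans h _; rewrite le_eqVlt; apply/orP; left; apply/eqP; ring.
Qed.

(** The derivative of [f / q] is the Wronskian divided by the square of [q]; the mean value theorem
    gives the inequality, cross-multiplied here to avoid quotients. *)
Lemma ratio_nondecreasing f q c :
    (forall x, 0 <= (wronskian f q).[x]) ->
    (forall x, c < x -> 0 < q.[x]) ->
  forall x y, c < x -> x <= y -> f.[x] * q.[y] <= f.[y] * q.[x].
Proof.
move=> w_ge0 q_gt0 x y cx; rewrite le_eqVlt => /predU1P[->//|xy].
have cz z : x <= z -> c < z by apply: lt_le_trans.
have q_neq0 z : x <= z -> q.[z] != 0 by move=> /cz/q_gt0; rewrite lt0r => /andP[].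
pose g z := f.[z] * (q.[z])^-1.
pose dg z : R := f.[z] *: (- q.[z] ^- 2 *: q^`().[z]) + q.[z]^-1 *: f^`().[z].
have gP z : x <= z -> is_derive z 1 g (dg z).
  move=> xz; have dq := is_deriveV (q_neq0 z xz) (is_derive_poly q z).
  exact: is_deriveM.
have [z zxy||] := MVT xy (f := g) (df := dg).
- by apply: gP; rewrite (itvP zxy).
- apply: derivable_within_continuous => z zxy.
  by have [] := gP z _; rewrite // (itvP zxy).
move=> z zxy; have xz : x <= z by rewrite (itvP zxy).
have qz := q_neq0 z xz.
have dg_ge0 : 0 <= dg z.
  have -> : dg z = (wronskian f q).[z] * q.[z] ^- 2.
    have quotient_rule (a b a' b' : R) : b != 0 ->
        a * (- b ^- 2 * b') + b^-1 * a' = (a' * b - a * b') * b ^- 2.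
      by move=> b_neq0; field.
    by rewrite /dg !hornerE; exact: quotient_rule.
  by rewrite mulr_ge0 // invr_ge0 sqr_ge0.
have qx : 0 < q.[x] by exact: q_gt0.
have qy : 0 < q.[y] by rewrite q_gt0 // cz // ltW.
move=> /eqP; rewrite subr_eq => /eqP gy.
rewrite -ler_pdivrMr // mulrAC -ler_pdivlMr // -/(g x) -/(g y) gy.
by rewrite lerDr mulr_ge0 // subr_ge0 ltW.
Qed.

Lemma select_above_roots f1 f2 q c :
    (forall x, 0 <= (wronskian f1 q).[x]) ->
    (forall x, 0 <= (wronskian f2 q).[x]) -> 0 < lead_coef q ->
    (forall x, c < x -> 0 < (f1 + f2).[x]) ->
  (forall x, c < x -> 0 < f1.[x]) \/ (forall x, c < x -> 0 < f2.[x]).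
Proof.
move=> w1 w2 lq f_gt0.
(* The Wronskian inequality also says that q / (f1 + f2) is nonincreasing on
   [c, +oo[, and it is positive far to the right. *)
have q_gt0 x : c < x -> 0 < q.[x].
  move=> cx; have [n qn] := poly_pinfty_gt_lc lq.
  have w x' : 0 <= (wronskian (- q) (f1 + f2)).[x'].
    have -> : wronskian (- q) (f1 + f2) = wronskian f1 q + wronskian f2 q.
      by rewrite derivD derivN; ring.
    by rewrite hornerD addr_ge0.
  have := ratio_nondecreasing w f_gt0 cx (y := Num.max n x).
  rewrite le_max lexx orbT !hornerN => /(_ isT); rewrite !mulNr lerN2.
  have qmax : 0 < q.[Num.max n x].
    by apply: lt_le_trans lq (qn _ _); rewrite le_max lexx.
  have /f_gt0 fmax : c < Num.max n x by rewrite lt_max cx orbT.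
  move=> h; rewrite -(pmulr_lgt0 _ fmax); apply: lt_le_trans h.
  by rewrite mulr_gt0 // f_gt0.
have [?|/existsNP[x1 /not_implyP[cx1 /negP]]] := pselect (forall x, c < x -> 0 < f1.[x]).
  by left.
rewrite -leNgt => f1x1; right=> x cx; rewrite ltNge; apply/negP => f2x.
(* Both ratios to [q] are nondecreasing, so nonpositive values of [f1] at [x1] and of [f2] at [x]
   propagate left to the common point [m], where the sum is positive. *)
pose m := Num.min x1 x; have cm : c < m by rewrite lt_min cx1.
have le0 f z : (forall x, 0 <= (wronskian f q).[x]) -> m <= z -> f.[z] <= 0 -> f.[m] <= 0.
  move=> w mz fz; have := ratio_nondecreasing w q_gt0 cm mz.
  have qz := q_gt0 z (lt_le_trans cm mz).
  rewrite -(pmulr_lle0 _ qz) => /le_trans; apply.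
  by rewrite mulr_le0_ge0 // ltW // q_gt0.
have := f_gt0 m cm; rewrite hornerD ltNge => /negP; apply.
by rewrite -[leRHS]addr0 lerD // ?(le0 f1 x1) ?(le0 f2 x) // ge_min lexx ?orbT.
Qed.

Lemma poly_gt0_above_roots p c t :
  0 < lead_coef p -> (forall x, root p x -> x <= c) -> c < t -> 0 < p.[t].
Proof.
move=> lp roots ct; rewrite ltNge; apply/negP => pt.
have [n pn] := poly_pinfty_gt_lc lp.
have tm : t <= Num.max n t by rewrite le_max lexx orbT.
have pm : 0 <= p.[Num.max n t] by rewrite (le_trans (ltW lp)) // pn // le_max lexx.
have ptm : p.[t] <= 0 <= p.[Num.max n t] by rewrite pt.
have [x /andP[tx _] /roots] := poly_ivt tm ptm.
by rewrite leNgt (lt_le_trans ct tx).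
Qed.

End RealPoly.

(** * Determinants with one or two rows replaced *)

Section SetRow.
Variables (A : comNzRingType) (n : nat).
Implicit Types (M : 'M[A]_n) (r s : 'rV[A]_n) (i j : 'I_n) (x y : A).

Definition set_row M i r : 'M[A]_n :=
  \matrix_(k, l) if k == i then r 0 l else M k l.

Lemma det_set_rowD M i r s x :
  \det (set_row M i (r + x *: s))
    = \det (set_row M i r) + x * \det (set_row M i s).
Proof.
rewrite -[\det (set_row M i r)]mul1r; apply: (@determinant_multilinear _ _ _ _ _ i).
- by apply/rowP => l; rewrite !mxE eqxx mul1r.
- by apply/matrixP => k l; rewrite !mxE eq_sym (negPf (neq_lift _ _)).
- by apply/matrixP => k l; rewrite !mxE eq_sym (negPf (neq_lift _ _)).
Qed.

Lemma det_set_row2D M i j r1 s1 r2 s2 x y : i != j ->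
  let S a b := \det (set_row (set_row M i a) j b) in
  S (r1 + x *: s1) (r2 + y *: s2)
    = S r1 r2 + x * S s1 r2 + y * S r1 s2 + x * y * S s1 s2.
Proof.
move=> ij S.
have SC a b : S a b = \det (set_row (set_row M j b) i a).
  congr (\det _); apply/matrixP => k l; rewrite !mxE.
  by case: (k =P i) => [->|//]; rewrite (negPf ij).
have SDl a b c t : S (a + t *: c) b = S a b + t * S c b.
  by rewrite !SC det_set_rowD.
by rewrite /S det_set_rowD -!/(S _ _) !SDl; ring.
Qed.

(** Expansion along row [i] leaves only the diagonal cofactor, which does not see column [i]; that
    column may therefore be cleared as well. *)
Lemma det_unit_row M i : row i M = delta_mx 0 i ->
  \det M = \det (\matrix_(k, l) if (k == i) || (l == i) then (k == l)%:R
                                else M k l).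
Proof.
move=> Mi; have Mil l : M i l = (i == l)%:R.
  by move/rowP/(_ l): Mi; rewrite !mxE eqxx eq_sym.
rewrite (expand_det_row _ i) [RHS](expand_det_row _ i); apply: eq_bigr => l _.
rewrite Mil mxE eqxx /=; case: (i =P l) => [<-|]; last by rewrite !mul0r.
congr (_ * (_ * \det _)); apply/matrixP => k m; rewrite !mxE.
by rewrite !(eq_sym _ i) !(negPf (neq_lift _ _)).
Qed.

(** Putting the sum of the two unit vectors in both rows gives determinant 0; in the bilinear
    expansion the two terms with equal rows vanish too. *)
Lemma det_set_row_swap M i j : i != j ->
  \det (set_row (set_row M i (delta_mx 0 j)) j (delta_mx 0 i))
    = - \det (set_row (set_row M i (delta_mx 0 i)) j (delta_mx 0 j)).
Proof.
move=> ij; have alt r : \det (set_row (set_row M i r) j r) = 0.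
  apply: (determinant_alternate ij) => l; rewrite !mxE eqxx.
  by rewrite (negPf ij) eqxx.
have := alt (delta_mx 0 i + 1 *: delta_mx 0 j).
rewrite (det_set_row2D M _ _ _ _ _ _ ij) /= !alt => h.
by apply/eqP; rewrite -addr_eq0; apply/eqP; rewrite -[RHS]h; ring.
Qed.

End SetRow.

(** * Principal minors, edge operators and the matching polynomial *)

Section MixedPoly.
Variable V : finType.
Implicit Types (W e : {set V}) (L : seq {set V}) (u v : V).

Section Def.
Variable A : comNzRingType.
Implicit Types (H : V -> V -> A) (z : V -> A).

(* Rows and columns outside W are replaced by those of the identity, so that the
   determinant is the principal minor of [diag z - H] on W and no matrix changes
   its size. *)
Definition minor_mx H z W : 'M[A]_#|V| :=
  \matrix_(i, j)
    let u := enum_val i in let v := enum_val j in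
    if (u \in W) && (v \in W) then (u == v)%:R * z u - H u v else (u == v)%:R.

(* [prod_(uv in L) (1 - d/dz_u d/dz_v)] applied to the minor on W: the operator
   d/dz_u acts as the deletion of u from W. *)
Fixpoint mixed L H z W : A :=
  if L is e :: L' then
    mixed L' H z W - (if e \subset W then mixed L' H z (W :\: e) else 0)
  else \det (minor_mx H z W).

Definition update z u (x : A) := fun v => if v == u then x else z v.

Definition add_edge H u v (x y : A) := fun a b =>
  H a b + (if (a == u) && (b == v) then x else
           if (a == v) && (b == u) then y else 0).

(** Every determinant reached by the recursion is a minor on a subset of [W]. *)
Lemma eq_mixed L H H' z z' W :
  {in W &, forall a b, H a b = H' a b} -> {in W, z =1 z'} ->
  mixed L H z W = mixed L H' z' W.
Proof.
elim: L W => [|e L IHL] W eqH eqz /=.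
  congr (\det _); apply/matrixP => i j; rewrite !mxE /=.
  by case: ifP => // /andP[iW jW]; rewrite eqH ?eqz.
rewrite IHL //; congr (_ - _); case: ifP => // _; apply: IHL.
  by move=> a b; rewrite !inE => /andP[_ aW] /andP[_ bW]; apply: eqH.
by move=> a; rewrite !inE => /andP[_ aW]; apply: eqz.
Qed.

Lemma enum_val_eq (i : 'I_#|V|) u : (enum_val i == u) = (i == enum_rank u).
Proof. by rewrite (can2_eq enum_valK enum_rankK). Qed.

(** The variable [z u] occurs only in the diagonal entry of row [u]. Its coefficient is the
    determinant with that row replaced by a unit vector, hence the minor without [u] by
    [det_unit_row]. *)
Lemma minor_affine H z W u : u \in W ->
  \det (minor_mx H z W) = \det (minor_mx H (update z u 0) W)
                          + z u * \det (minor_mx H z (W :\ u)).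
Proof.
move=> uW; set i := enum_rank u; set M := minor_mx H (update z u 0) W.
have -> : minor_mx H z W = set_row M i (row i M + z u *: delta_mx 0 i).
  apply/matrixP => k l; rewrite !mxE /= /update !(inj_eq enum_val_inj) !enum_val_eq.
  rewrite -/i; case: (k =P i) => [->|//]; rewrite /i !enum_rankK uW -/i (eq_sym i).
  case: (l =P i) => [->|_] /=; first by rewrite /i enum_rankK uW eqxx; ring.
  by case: ifP => _; ring.
rewrite det_set_rowD; congr (\det _ + _ * _).
  by apply/matrixP => k l; rewrite !mxE; case: (k =P i) => [->|].
rewrite (@det_unit_row _ _ _ i); last by apply/rowP => l; rewrite !mxE !eqxx.
congr (\det _); apply/matrixP => k l.
rewrite !mxE /= /update !inE !(inj_eq enum_val_inj) !enum_val_eq -/i.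
by case: (k =P i) => [->|_] /=; case: (l =P i) => [->|_] //=; rewrite ?andbF.
Qed.

Lemma mixed_affine L H z W u : u \in W ->
  mixed L H z W = mixed L H (update z u 0) W + z u * mixed L H z (W :\ u).
Proof.
elim: L W => [|e L IHL] W uW /=; first exact: minor_affine.
rewrite (IHL _ uW) subsetD1.
case: ifP => eW /=; last by rewrite !subr0.
(* If [u] lies in [e], deleting [e] removes [u]: the subtracted term does not depend on [z u] and
   has no counterpart on [W :\ u]. *)
have [ue|une] /= := boolP (u \in e).
  rewrite subr0 addrAC; congr (_ - _ + _); apply: eq_mixed => // a.
  by rewrite /update; case: (a =P u) => // ->; rewrite inE ue.
rewrite (IHL (W :\: e)) ?inE ?une //.
have -> : W :\: e :\ u = W :\ u :\: e.
  by apply/setP => a; rewrite !inE andbCA.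
by ring.
Qed.

(** Expanding rows [u] and [v] bilinearly, the terms linear in [x] or [y] cancel between the two
    signs. The term in [x * y] has the two unit rows interchanged, so it is minus the minor without
    [u] and [v]. If an endpoint is outside [W], the new entries do not occur. *)
Lemma minor_add_edge H z W u v x y : u != v -> x * y = 1 ->
  \det (minor_mx (add_edge H u v x y) z W)
    + \det (minor_mx (add_edge H u v (- x) (- y)) z W)
  = (\det (minor_mx H z W) -
     (if [set u; v] \subset W then \det (minor_mx H z (W :\: [set u; v]))
      else 0)) *+ 2.
Proof.
move=> uv xy1; rewrite subUset !sub1set; set M := minor_mx H z W.
case: ifPn => [/andP[uW vW]|uvW]; last first.
  have same a b : minor_mx (add_edge H u v a b) z W = M.
    apply/matrixP => k l; rewrite !mxE /= /add_edge; case: ifP => // kl.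
    case: ifP => [/andP[/eqP ku /eqP lv]|_].
      by move: uvW; rewrite -ku -lv kl.
    case: ifP => [/andP[/eqP ku /eqP lv]|_]; last by rewrite addr0.
    by move: uvW; rewrite -ku -lv andbC kl.
  by rewrite !same subr0.
set i := enum_rank u; set j := enum_rank v.
have ij : i != j by rewrite (inj_eq enum_rank_inj).
have rowsE a b : minor_mx (add_edge H u v a b) z W =
    set_row (set_row M i (row i M + (- a) *: delta_mx 0 j)) j
      (row j M + (- b) *: delta_mx 0 i).
  apply/matrixP => k l.
  rewrite !mxE /= /add_edge !(inj_eq enum_val_inj) !enum_val_eq -/i -/j.
  case: (k =P j) => [->|_].
    rewrite (eq_sym j i) (negPf ij) /= /j enum_rankK vW -/j.
    case: (l =P i) => [->|_] /=; first by rewrite /i enum_rankK uW; ring.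
    by case: ifP => _; ring.
  case: (k =P i) => [->|_]; last by rewrite addr0.
  rewrite /i enum_rankK uW -/i /=.
  case: (l =P j) => [->|_] /=; first by rewrite /j enum_rankK vW; ring.
  by case: ifP => _; ring.
have idM : set_row (set_row M i (row i M)) j (row j M) = M.
  apply/matrixP => k l; rewrite !mxE; case: (k =P j) => [->//|_].
  by case: (k =P i) => [->|].
have pM : \det (set_row (set_row M i (delta_mx 0 i)) j (delta_mx 0 j)) =
    \det (minor_mx H z (W :\: [set u; v])).
  rewrite (@det_unit_row _ _ _ i); last first.
    by apply/rowP => l; rewrite !mxE (negPf ij) !eqxx.
  rewrite (@det_unit_row _ _ _ j); last first.
    apply/rowP => l; rewrite !mxE eqxx /= (eq_sym j) (negPf ij) /=.
    by rewrite (eq_sym j); case: (l =P i) => [->|]; rewrite ?(negPf ij).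
  congr (\det _); apply/matrixP => k l.
  rewrite !mxE /= !inE !(inj_eq enum_val_inj) !enum_val_eq -/i -/j.
  case: (k =P j) => [->|_]; first by rewrite orbT.
  case: (l =P j) => [->|_]; first by rewrite /= orbT andbF.
  by case: (k =P i) => //= _; case: (l =P i) => //= _; rewrite andbF.
rewrite !rowsE !det_set_row2D // idM det_set_row_swap // pM !opprK.
by rewrite mulrNN xy1; ring.
Qed.

(** The edge operators commute, so the one for [uv] can be carried past [L]; if [e] meets [uv], the
    term deleting both is absent in either order. *)
Lemma mixed_add_edge L H z W u v x y : u != v -> x * y = 1 ->
  mixed L (add_edge H u v x y) z W + mixed L (add_edge H u v (- x) (- y)) z W
  = mixed ([set u; v] :: L) H z W *+ 2.
Proof.
move=> uv xy1; elim: L W => [|e L IHL] W /=; first exact: minor_add_edge.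
rewrite addrACA IHL /= -opprD; set c := [set u; v].
have -> : W :\: c :\: e = W :\: e :\: c by rewrite !setDDl setUC.
have := IHL (W :\: e); rewrite /= -/c !subsetD (disjoint_sym c e).
case: (e \subset W) => /= [->|_]; last by case: (c \subset W); ring.
by case: (c \subset W) => /=; case: [disjoint e & c]; ring.
Qed.

End Def.

Lemma rmorph_mixed (A B : comNzRingType) (f : {rmorphism A -> B})
    L (H : V -> V -> A) z W :
  f (mixed L H z W) = mixed L (fun a b => f (H a b)) (f \o z) W.
Proof.
elim: L W => [|e L IHL] W /=.
  rewrite -det_map_mx; congr (\det _); apply/matrixP => i j; rewrite !mxE /=.
  by case: ifP => _; rewrite ?rmorphB ?rmorphM /= rmorph_nat.
by rewrite rmorphB /= IHL; case: ifP => _; rewrite ?IHL ?rmorph0.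
Qed.


Lemma mixed_tr (A : comNzRingType) L (H : V -> V -> A) z W :
  mixed L (fun a b => H b a) z W = mixed L H z W.
Proof.
elim: L W => [|e L IHL] W /=; last by rewrite !IHL.
rewrite -det_tr; congr (\det _); apply/matrixP => i j; rewrite !mxE /= andbC.
rewrite !(inj_eq enum_val_inj).
by have [->//|_] := eqVneq i j; rewrite !mul0r.
Qed.

Lemma det_minor0 (A : comNzRingType) (x : A) W :
  \det (minor_mx (fun _ _ => 0) (fun=> x) W) = x ^+ #|W|.
Proof.
have -> : minor_mx (fun _ _ => 0) (fun=> x) W =
    diag_mx (\row_i (if enum_val i \in W then x else 1)).
  apply/matrixP => i j; rewrite !mxE /= subr0 (inj_eq enum_val_inj).
  by case: (i =P j) => [->|_]; rewrite ?mul1r ?mul0r ?andbb //; case: ifP.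
rewrite det_diag; under eq_bigr do rewrite mxE.
rewrite -(big_enum_val (A := V) (fun u => if u \in W then x else 1)) /=.
by rewrite -big_mkcond prodr_const.
Qed.

Lemma trivIsetU1E e (M : {set {set V}}) : e \notin M ->
  trivIset (e |: M) = trivIset M && [disjoint e & cover M].
Proof.
move=> eM; apply/idP/andP => [/trivIsetP tM|[/trivIsetP tM deM]].
  split.
    by apply/trivIsetP => B C BM CM; apply: tM; rewrite inE ?BM ?CM orbT.
  apply/bigcup_disjointP => B BM; apply: tM; rewrite ?setU11 // ?inE ?BM ?orbT //.
  by apply: contraNneq eM => ->.
apply/trivIsetP => B C; rewrite !inE.
have deB B' : B' \in M -> [disjoint e & B'].
  by move=> BM; apply: disjointWr deM; apply: bigcup_sup.
case/predU1P => [->|BM] /predU1P[->|CM]; rewrite ?eqxx // => BC.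
- exact: deB.
- by rewrite disjoint_sym deB.
- exact: tM.
Qed.

(** The recursion of [mixed] splits matchings according to the head edge [e]: those containing [e]
    correspond to matchings by the remaining edges inside [W :\: e], with the opposite sign. *)
Lemma mixed_matchings (A : comNzRingType) (x : A) L W : uniq L ->
  mixed L (fun _ _ => 0) (fun=> x) W =
  \sum_(M : {set {set V}} |
          [&& M \subset [set e in L], trivIset M & cover M \subset W])
     (-1) ^+ #|M| * x ^+ #|W :\: cover M|.
Proof.
elim: L W => [|e L IHL] W /=.
  have -> : [set e in [::]] = set0 :> {set {set V}} by apply/setP => e; rewrite !inE.
  rewrite det_minor0 (big_pred1 set0) => [|M].
    by rewrite cards0 mul1r /cover big_set0 setD0.
  rewrite subset0 /=; case: (M =P set0) => [->|//] /=.
  by rewrite /cover big_set0 sub0set andbT; apply/trivIsetP => B C; rewrite inE.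
move=> /andP[eL uL]; rewrite (bigID (fun M : {set {set V}} => e \in M)) /= addrC.
have -> : [set f in e :: L] = e |: [set f in L] by apply/setP => f; rewrite !inE.
have eS : e \notin [set f in L] by rewrite inE.
congr (_ + _).
  rewrite IHL //; apply: eq_bigl => M.
  by rewrite -{1}(setU1K eS) subsetD1 -!andbA; do 3!bool_congr.
have coverU M : cover (e |: M) = e :|: cover M.
  by rewrite /cover bigcup_setU big_set1.
case: ifPn => eW; last first.
  rewrite oppr0 big_pred0 // => M; apply/negbTE; apply: contra eW.
  by case/andP => /and3P[_ _ /bigcupsP MW] /MW.
rewrite IHL // -sumrN [RHS](reindex_onto (fun M : {set {set V}} => e |: M)
  (fun M => M :\ e)) /=.
  apply: eq_big => M; last first.
    move=> /and3P[MS _ _]; have eM : e \notin M by apply: contra eS => /(subsetP MS).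
    by rewrite cardsU1 eM exprS coverU setDDl !mulN1r mulNr.
  rewrite setU11 andbT coverU !subUset eW sub1set setU11 /=.
  (* Sets containing [e] drop out on both sides: they are not contained in [L], and removing [e]
     from [e |: M] does not give back [M]. *)
  have [eM|eM] := boolP (e \in M).
    have -> : ((e |: M) :\ e == M) = false.
      by apply/negbTE; apply: contraTneq eM => <-; rewrite !inE eqxx.
    rewrite andbF; apply/negbTE; rewrite !negb_and; apply/orP; left.
    by apply: contra eS => /subsetP/(_ e eM).
  rewrite setU1K // eqxx andbT trivIsetU1E // -{1}(setU1K eS) subsetD1 eM andbT.
  by rewrite subsetD disjoint_sym -!andbA; do 2!bool_congr; rewrite andbC.
by move=> M /andP[_ eM]; rewrite setD1K.
Qed.

Lemma mixed_matching_poly (A : comNzRingType) (G : rel V) : simple_graph G ->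
  mixed (enum (edges G)) (fun _ _ => 0) (fun=> 'X) [set: V] = matching_poly A G.
Proof.
move=> sG; rewrite mixed_matchings ?enum_uniq //.
have -> : [set e in enum (edges G)] = edges G.
  by apply/setP => e; rewrite inE mem_enum.
have cardM (M : {set {set V}}) : M \subset edges G -> trivIset M -> #|cover M| = #|M|.*2.
  move=> MG /eqP <-; rewrite (eq_bigr (fun=> 2%N)) => [|e eM].
    by rewrite sum_nat_const muln2.
  exact: card_edge sG (subsetP MG e eM).
(* A matching covers twice as many vertices as it has edges, so [#|M|] is within the range of
   [inord], which then returns it unchanged. *)
rewrite (partition_big (fun M : {set {set V}} => inord #|M| : 'I_(#|V|./2).+1) predT) //=.
apply: eq_bigr => k _; rewrite (eq_bigl (mem (matchings G k))); last first.
  move=> M; rewrite !inE subsetT andbT.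
  apply/andP/and3P => [[/andP[MG tM] /eqP <-]|[MG tM /eqP Mk]].
    have : (#|M|.*2 <= #|V|)%N by rewrite -cardM // max_card.
    by move=> /half_leq; rewrite doubleK => Mle; rewrite MG tM inordK ?ltnS.
  by rewrite MG tM Mk inord_val.
rewrite (eq_bigr (fun=> (-1) ^+ k *: 'X^(#|V| - k.*2))) => [|M].
  by rewrite sumr_const -scaler_nat scalerA mulrC.
move=> /[!inE] /and3P[MG tM /eqP Mk].
rewrite setTD cardsCs setCK cardM // Mk.
by rewrite -[RHS]mul_polyC rmorphXn /= rmorphN1.
Qed.

End MixedPoly.


(** * Nonvanishing in the upper half plane and the choice of one sign *)

Section Stability.
Variables (R : realType) (V : finType).
Local Notation C := R[i].
Implicit Types (H : V -> V -> C) (z : V -> C) (W : {set V}) (L : seq {set V}).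
Implicit Types (u v : V) (x y : C).

Lemma ImD x y : complex.Im (x + y) = complex.Im x + complex.Im y.
Proof. by case: x; case: y. Qed.

Lemma ImN x : complex.Im (- x) = - complex.Im x.
Proof. by case: x. Qed.

Lemma ImV x : 0 < complex.Im x -> complex.Im x^-1 < 0.
Proof.
case: x => a b /= b_gt0.
rewrite -mulNr pmulr_llt0 ?oppr_lt0 // invr_gt0.
by rewrite ltr_wpDl ?sqr_ge0 // exprn_gt0.
Qed.

Definition hermitian_fun H := forall a b, H b a = conjc (H a b).

(** A left kernel vector [v] gives [T], the value at [v] of the Hermitian form of [K], as the sum of
    [d j] times the squared modulus of [v 0 j]. Since [T] is real, the imaginary parts sum to 0,
    which forces [v] to vanish on [W]; outside [W] the matrix is the identity. *)
Lemma minor_stable H z W : hermitian_fun H ->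
  {in W, forall a, 0 < complex.Im (z a)} -> \det (minor_mx H z W) != 0.
Proof.
move=> hH zW; apply/det0P => -[v v_neq0 vM].
have vj j : \sum_i v 0 i * minor_mx H z W i j = 0.
  by move/matrixP/(_ 0 j): vM; rewrite !mxE.
pose d (j : 'I_#|V|) := if enum_val j \in W then z (enum_val j) else 1.
pose K (i j : 'I_#|V|) := if (enum_val i \in W) && (enum_val j \in W)
  then H (enum_val i) (enum_val j) else 0.
have KJ i j : K j i = conjc (K i j).
  by rewrite /K andbC; case: ifP => _; [exact: hH | rewrite conjc0].
have ME i j : minor_mx H z W i j = (i == j)%:R * d j - K i j.
  rewrite mxE /= (inj_eq enum_val_inj) /K /d.
  have [->|_] := eqVneq i j.
    by rewrite andbb; case: ifP => _; rewrite ?mul1r ?subr0.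
  by rewrite !mul0r; case: ifP => _; rewrite ?subr0.
pose T := \sum_j (\sum_i v 0 i * K i j) * conjc (v 0 j).
have TJ : conjc T = T.
  rewrite rmorph_sum /T; under [RHS]eq_bigr do rewrite mulr_suml.
  rewrite exchange_big /=; apply: eq_bigr => i _.
  rewrite [LHS]rmorphM [X in X * _]rmorph_sum mulr_suml; apply: eq_bigr => j _.
  by rewrite [X in X * _]rmorphM /= conjcK -KJ; ring.
have TE : T = \sum_j d j * `|v 0 j| ^+ 2.
  apply/esym/eqP; rewrite -subr_eq0 -sumrB big1 // => j _.
  rewrite sqr_normc mulrA -mulrBl.
  have := vj j; under eq_bigr do rewrite ME mulrBr.
  rewrite sumrB (bigD1 j) //= eqxx mul1r big1 ?addr0 => [|i /negPf->]; last first.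
    by rewrite mul0r mulr0.
  by rewrite [d j * _]mulrC => ->; rewrite mul0r.
have sumIm : \sum_j (complex.Im (d j))%:C%C * `|v 0 j| ^+ 2 = 0.
  have : T - conjc T = 0 by rewrite TJ subrr.
  have conj2 (a : C) : conjc (`|a| ^+ 2) = `|a| ^+ 2.
    by rewrite sqr_normc [LHS]rmorphM /= conjcK mulrC.
  rewrite {1}TE {1}TE rmorph_sum -sumrB /=.
  rewrite (eq_bigr (fun j => (2%:R * 'i%C) * ((complex.Im (d j))%:C%C * `|v 0 j| ^+ 2))).
    rewrite -mulr_sumr => /eqP; rewrite !mulf_eq0 pnatr_eq0 /=.
    rewrite eq_complex /= oner_eq0 andbF /= => /eqP //.
  move=> j _; have -> : conjc (d j * `|v 0 j| ^+ 2) = conjc (d j) * `|v 0 j| ^+ 2.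
    by apply: etrans (rmorphM _ _ _) _; congr (_ * _); exact: conj2.
  by rewrite -mulrBl subcJ; ring.
have d_ge0 j : true -> 0 <= (complex.Im (d j))%:C%C * `|v 0 j| ^+ 2.
  move=> _; rewrite mulr_ge0 ?exprn_ge0 ?normr_ge0 // lecR /d.
  by case: ifP => [/zW/ltW|].
have Im0 := psumr_eq0P d_ge0 sumIm.
case/negP: v_neq0; apply/eqP/rowP => j; rewrite mxE.
have [jW|jW] := boolP (enum_val j \in W).
  have /eqP := Im0 j isT; rewrite mulf_eq0 /d jW expf_eq0 /= normr_eq0.
  case/orP => /eqP //; move/complexI => dj.
  by have := zW _ jW; rewrite dj ltxx.
have := vj j; rewrite (bigD1 j) //= big1 => [|i ij].
  by rewrite ME eqxx /K /d (negPf jW) andbF subr0 !mulr1 addr0.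
by rewrite ME (negPf ij) /K (negPf jW) andbF subr0 mul0r mulr0.
Qed.

Lemma mixed_ratio L H z W u : u \in W ->
    (forall z', {in W, forall a, 0 < complex.Im (z' a)} -> mixed L H z' W != 0) ->
    mixed L H z (W :\ u) != 0 -> {in W, forall a, 0 < complex.Im (z a)} ->
  complex.Im (z u) <= complex.Im (mixed L H z W / mixed L H z (W :\ u)).
Proof.
move=> uW stable Wu_neq0 zW; rewrite leNgt; apply/negP.
(* Otherwise moving [z u] to [z u - t] would produce a zero of [mixed L H _ W]. *)
set t := _ / _ => tz.
have := stable (update z u (z u - t)); rewrite (mixed_affine _ _ _ uW).
have -> : mixed L H (update z u (z u - t)) (W :\ u) = mixed L H z (W :\ u).
  by apply: eq_mixed => // a; rewrite /update !inE => /andP[/negPf->].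
have -> : mixed L H (update (update z u (z u - t)) u 0) W = mixed L H (update z u 0) W.
  by apply: eq_mixed => // a _; rewrite /update; case: eqP.
have -> : update z u (z u - t) u = z u - t by rewrite /update eqxx.
rewrite mulrBl divfK // addrA -(mixed_affine _ _ _ uW) subrr eqxx.
suff zW' : {in W, forall a, 0 < complex.Im (update z u (z u - t) a)} by move=> /(_ zW').
move=> a aW; rewrite /update; case: (a =P u) => [_|_]; last exact: zW.
by rewrite ImD ImN subr_gt0.
Qed.

(** A zero would equate the values of [mixed L] on [W] and on [W :\ u :\ v]. Divided by the value on
    [W :\ u], the first has positive imaginary part by [mixed_ratio], and the second negative, being
    the inverse of such a ratio. *)
Lemma mixed_stable L H z W : {in L, forall e : {set V}, #|e| = 2%N} -> hermitian_fun H ->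
  {in W, forall a, 0 < complex.Im (z a)} -> mixed L H z W != 0.
Proof.
move=> + hH; elim: L W z => [|e L IHL] W z cardL zW /=; first exact: minor_stable.
have {}IHL W' z' : {in W', forall a, 0 < complex.Im (z' a)} -> mixed L H z' W' != 0.
  by apply: IHL => f fL; rewrite cardL // inE fL orbT.
case: ifP => eW; last by rewrite subr0 IHL.
have /eqP/cards2P[u [v [uv De]]] := cardL e (mem_head _ _).
move: eW; rewrite De subUset !sub1set => /andP[uW vW].
have -> : W :\: [set u; v] = W :\ u :\ v.
  by apply/setP => a; rewrite !inE negb_or; case: (a == u); case: (a == v).
have zWu : {in W :\ u, forall a, 0 < complex.Im (z a)}.
  by move=> a; rewrite inE => /andP[_ /zW].
have zWuv : {in W :\ u :\ v, forall a, 0 < complex.Im (z a)}.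
  by move=> a; rewrite inE => /andP[_ /zWu].
have vWu : v \in W :\ u by rewrite !inE eq_sym uv.
have r1 := mixed_ratio uW (fun z' => IHL W z') (IHL _ _ zWu) zW.
have r2 := mixed_ratio vWu (fun z' => IHL _ z') (IHL _ _ zWuv) zWu.
have := lt_le_trans (zW u uW) r1; have := ImV (lt_le_trans (zW v vW) r2).
rewrite invf_div subr_eq0 => h1 h2; apply/eqP => eqW.
by move: h2; rewrite eqW ltNge ltW.
Qed.


Definition mixed_poly L H W : {poly C} :=
  mixed L (fun a b => (H a b)%:P) (fun=> 'X) W.

Lemma horner_mixed_poly L H W x :
  (mixed_poly L H W).[x] = mixed L H (fun=> x) W.
Proof.
apply: etrans (rmorph_mixed (horner_eval x) L _ _ W) _.
by apply: eq_mixed => [a b _ _|a _] /=; rewrite /horner_eval !hornerE.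
Qed.

(** Conjugating a Hermitian matrix transposes it, and [mixed] is invariant under transposition. *)
Lemma mixed_poly_conj L H W : hermitian_fun H ->
  map_poly (@conjc R) (mixed_poly L H W) = mixed_poly L H W.
Proof.
move=> hH; rewrite /mixed_poly -[RHS]mixed_tr.
apply: etrans (rmorph_mixed (map_poly (@conjc R)) _ _ _ _) _.
apply: eq_mixed => [a b _ _|a _] /=; last by rewrite map_polyX.
by rewrite map_polyC /= -hH.
Qed.

(** For Hermitian [H] the coefficients are already real ([real_mixedE]), so the real part only
    changes their type. *)
Definition real_mixed L H W : {poly R} := map_poly (@complex.Re R) (mixed_poly L H W).

Lemma real_mixedE L H W : hermitian_fun H ->
  map_poly (real_complex R) (real_mixed L H W) = mixed_poly L H W.
Proof.
move=> hH; apply/polyP => k; rewrite coef_map /= coef_map_id0 //.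
have : conjc (mixed_poly L H W)`_k = (mixed_poly L H W)`_k.
  by rewrite -[in RHS](mixed_poly_conj _ _ hH) coef_map.
case: (_`_k) => a b [] /= /eqP; rewrite eq_sym -subr_eq0 opprK -mulr2n.
by rewrite mulrn_eq0 /= => /eqP->.
Qed.

Lemma minor_poly_monic H W :
  mixed_poly [::] H W \is monic /\ size (mixed_poly [::] H W) = #|W|.+1.
Proof.
pose K : 'M[C]_#|V| := \matrix_(i, j)
  if (enum_val i \in W) && (enum_val j \in W)
  then H (enum_val i) (enum_val j) else 0.
pose d : 'rV[{poly C}]_#|V| := \row_i (if enum_val i \in W then 1 else 'X).
(* Scaling by 'X the rows outside W gives the characteristic matrix of H
   restricted to W and extended by 0. *)
have KE : char_poly_mx K =
    diag_mx d *m minor_mx (fun a b => (H a b)%:P) (fun=> 'X) W.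
  rewrite mul_diag_mx; apply/matrixP => i j.
  rewrite !mxE /= (inj_eq enum_val_inj) -mulr_natl.
  have [->|_] := eqVneq i j.
    by rewrite andbb; case: ifP => _; rewrite ?mul1r ?mulr1 ?subr0.
  rewrite !mul0r; case: (enum_val i \in W); case: (enum_val j \in W) => /=;
  by rewrite ?polyC0 ?mulr0 ?mul1r ?subr0.
have dE : \det (diag_mx d) = 'X^#|~: W|.
  rewrite det_diag; under eq_bigr do rewrite mxE.
  rewrite -(big_enum_val (A := V) (fun u => if u \in W then 1 else 'X : {poly C})).
  rewrite /= -prodr_const [RHS]big_mkcond; apply: eq_bigr => u _.
  by rewrite inE; case: (u \in W).
have pE : char_poly K = 'X^#|~: W| * mixed_poly [::] H W.
  by rewrite /char_poly KE det_mulmx dE.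
have mon : mixed_poly [::] H W \is monic.
  by have := char_poly_monic K; rewrite pE monicMl // monicXn.
split=> //; have := size_char_poly K.
rewrite pE size_monicM ?monicXn ?monic_neq0 // size_polyXn /= => /eqP.
by rewrite -(cardsC W) -addSn addnC eqn_add2r => /eqP.
Qed.

(** Each edge operator subtracts a polynomial of smaller degree, since deleting a nonempty edge
    shrinks [W]. *)
Lemma mixed_poly_monic L H W : {in L, forall e : {set V}, #|e| = 2%N} ->
  mixed_poly L H W \is monic /\ size (mixed_poly L H W) = #|W|.+1.
Proof.
elim: L W => [|e L IHL] W cardL; first exact: minor_poly_monic.
have {}IHL W' : mixed_poly L H W' \is monic /\ size (mixed_poly L H W') = #|W'|.+1.
  by apply: IHL => f fL; rewrite cardL // inE fL orbT.
have [monW sizeW] := IHL W.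
rewrite {1 2}/mixed_poly /= -!/(mixed_poly _ _ _).
case: ifP => eW; last by rewrite subr0.
have lt : (size (- mixed_poly L H (W :\: e)) < size (mixed_poly L H W))%N.
  rewrite size_polyN !(proj2 (IHL _)) ltnS proper_card //.
  have /card_gt0P[a ae] : (0 < #|e|)%N by rewrite cardL ?mem_head.
  rewrite properE subsetDl; apply/subsetPn; exists a; first exact: (subsetP eW).
  by rewrite inE ae.
by rewrite monicE lead_coefDl ?size_polyDl // -monicE.
Qed.

Lemma real_mixed_lead_gt0 L H W : {in L, forall e : {set V}, #|e| = 2%N} ->
  hermitian_fun H -> 0 < lead_coef (real_mixed L H W).
Proof.
move=> cardL hH; have := (mixed_poly_monic H W cardL).1.
rewrite -real_mixedE // monicE lead_coef_map => /eqP h.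
by rewrite (_ : lead_coef _ = 1) ?ltr01 //; apply: complexI; rewrite h.
Qed.

(** With all variables equal to one point of the upper half plane, [F / Q] lies there too by
    [mixed_ratio], and [F * conjc Q] is a positive multiple of it. *)
Lemma real_mixed_wronskian L H W u : u \in W ->
    {in L, forall e : {set V}, #|e| = 2%N} -> hermitian_fun H ->
  let f := real_mixed L H W in let q := real_mixed L H (W :\ u) in
  forall t, 0 <= (f^`() * q - f * q^`()).[t].
Proof.
move=> uW cardL hH /=; apply: wronskian_ge0 => x x_gt0.
rewrite !real_mixedE // !horner_mixed_poly.
have stable W' (z : V -> C) : {in W', forall a, 0 < complex.Im (z a)} ->
    mixed L H z W' != 0 by exact: mixed_stable.
set F := mixed _ _ _ W; set Q := mixed _ _ _ (W :\ u).
have Q_neq0 : Q != 0 by apply: stable => a _.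
have := mixed_ratio (z := fun=> x) uW (stable W) Q_neq0 (fun a _ => x_gt0).
rewrite -/F -/Q => /(lt_le_trans x_gt0) r_gt0.
have -> : F * conjc Q = F / Q * `|Q| ^+ 2.
  by rewrite sqr_normc; field.
rewrite -add_Re2_Im2; case: (F / Q) r_gt0 => a b /= b_gt0.
by rewrite mulr0 add0r mulr_ge0 ?addr_ge0 ?sqr_ge0 // ltW.
Qed.

Lemma hermitian_add_edge H u v x : u != v -> hermitian_fun H ->
  hermitian_fun (add_edge H u v x (conjc x)).
Proof.
move=> uv hH a b; rewrite /add_edge [RHS]rmorphD /= -hH; congr (_ + _).
rewrite ![(b == _) && _]andbC.
have [/andP[/eqP-> /eqP->]|nuv] := boolP ((a == u) && (b == v)).
  by rewrite (negPf uv).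
by have [_|nvu] := boolP ((a == v) && (b == u)); rewrite ?conjcK ?conjc0.
Qed.

Lemma select_orientation L H u v x c :
    u != v -> {in L, forall e : {set V}, #|e| = 2%N} -> hermitian_fun H ->
    x * conjc x = 1 ->
    (forall t, c < t -> 0 < (real_mixed ([set u; v] :: L) H setT).[t]) ->
  exists b : bool, forall t, c < t ->
    0 < (real_mixed L (add_edge H u v ((-1) ^+ b * x) ((-1) ^+ b * conjc x)) setT).[t].
Proof.
move=> uv cardL hH xx1 pos.
pose Hx y := add_edge H u v y (conjc y).
have hHx y : hermitian_fun (Hx y) by exact: hermitian_add_edge.
have NJ : conjc (- x) = - conjc x by exact: rmorphN.
have uT : u \in [set: V] by rewrite inE.
(* Deleting [u] removes both entries of the edge, so one comparison polynomial serves both signs. *)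
have qE y : real_mixed L (Hx y) (setT :\ u) = real_mixed L H (setT :\ u).
  congr map_poly; apply: eq_mixed => // a b; rewrite !inE !andbT => au bu.
  by rewrite /Hx /add_edge (negPf au) (negPf bu) andbF addr0.
have sumE : real_mixed L (Hx x) setT + real_mixed L (Hx (- x)) setT =
    real_mixed ([set u; v] :: L) H setT *+ 2.
  apply: (@map_poly_inj _ _ (real_complex R)).
  rewrite rmorphD rmorphMn /= !real_mixedE // /mixed_poly.
  have xP : x%:P * (conjc x)%:P = 1 by rewrite -polyCM xx1.
  have /= <- := mixed_add_edge L (fun a b => (H a b)%:P) (fun=> 'X) [set: V] uv xP.
  congr (_ + _); apply: eq_mixed => // a b _ _; rewrite /Hx /add_edge ?NJ;
    by rewrite polyCD; congr (_ + _); do ?case: ifP => _; rewrite ?polyCN.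
have wr y t : 0 <= ((real_mixed L (Hx y) setT)^`() * real_mixed L H (setT :\ u)
    - real_mixed L (Hx y) setT * (real_mixed L H (setT :\ u))^`()).[t].
  by rewrite -(qE y); exact: real_mixed_wronskian.
have lead_gt0 := real_mixed_lead_gt0 (setT :\ u) cardL hH.
have [t ct|?|?] := select_above_roots (c := c) (wr x) (wr (- x)) lead_gt0.
- by rewrite sumE hornerMn pmulrn_lgt0 // pos.
- by exists false; rewrite !mul1r.
- by exists true; rewrite expr1 !mulN1r -NJ.
Qed.

End Stability.

Local Open Scope complex_scope.

Lemma set2_inj (T : finType) (a b u v : T) : a != b ->
  [set a; b] = [set u; v] -> (a = u /\ b = v) \/ (a = v /\ b = u).
Proof.
move=> ab eq_uv.
have /set2P au_or_av : a \in [set u; v] by rewrite -eq_uv set21.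
have /set2P bu_or_bv : b \in [set u; v] by rewrite -eq_uv set22.
case: au_or_av bu_or_bv => [au|av] [bu|bv]; [|by left|by right|].
  by rewrite au bu eqxx in ab.
by rewrite av bv eqxx in ab.
Qed.

(** * Switching signs along an acyclic graph *)

Section Switching.
Variables (V : finType) (T : rel V).
Hypotheses (simpleT : simple_graph T) (acyclicT : acyclic T).

Let remove_edge u v : rel V := fun a b => T a b && ([set a; b] != [set u; v]).

Lemma acyclic_bridge u v : T u v -> ~~ connect (remove_edge u v) u v.
Proof.
case: simpleT => symT irrT Tuv; apply/negP => /connectP[p up v_last].
case/shortenP: up v_last => p' up' uniq_p' _ v_last.
have subT : subrel (remove_edge u v) T by move=> a b /andP[].
apply: (acyclicT (c := u :: p')); last first.
  rewrite /ucycle /= rcons_path (sub_path subT up') -v_last symT Tuv.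
  exact: uniq_p'.
(* The closed path is a genuine cycle unless [p'] has at most one vertex; then [u = v], or the path
   uses the removed edge itself. *)
case: p' up' v_last {uniq_p'} => [_ vu|a [/andP[] + _ va|//]].
  by move: Tuv; rewrite vu irrT.
by rewrite va /remove_edge eqxx andbF.
Qed.

Lemma acyclic_switching (s : {set V} -> bool) :
  exists d : V -> bool, forall u v, T u v -> d u (+) d v = s [set u; v].
Proof.
have symT := simpleT.1.
suff [d dP] : exists d : V -> bool, forall p, p \in enum {: V * V} -> T p.1 p.2 ->
    d p.1 (+) d p.2 = s [set p.1; p.2].
  by exists d => u v; apply: (dP (u, v)); rewrite mem_enum.
elim: (enum _) => [|[u v] l [d dP]]; first by exists (fun=> false).
have [Tuv|nTuv] := boolP (T u v); last first.
  exists d => p; rewrite inE => /predU1P[->/= |]; last exact: dP.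
  by rewrite (negPf nTuv).
have [duv|duv] := eqVneq (d u (+) d v) (s [set u; v]).
  by exists d => p; rewrite inE => /predU1P[->//|]; apply: dP.
pose e' := remove_edge u v.
have sym_e' : connect_sym e'.
  by apply: sym_connect_sym => a b; rewrite /e' /remove_edge symT setUC.
(* Flip d on the component of u in T - uv; it does not contain v. *)
exists (fun a => d a (+) connect e' u a) => p.
rewrite inE => /predU1P[->|pl] /= Tp.
  rewrite connect0 (negPf (acyclic_bridge Tuv)) addbF addbT addNb.
  by apply/eqP; move: duv; case: (_ (+) _); case: (s _).
have same : d p.1 (+) d p.2 = s [set p.1; p.2] by exact: dP.
(* The list holds ordered pairs, so the edge may recur in it, possibly reversed; it would then
   already have the right parity, against [duv]. *)
have [eq_uv|neq_uv] := eqVneq [set p.1; p.2] [set u; v].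
  case/negP: duv; rewrite -eq_uv -same; apply/eqP.
  have p12 : p.1 != p.2 by apply: contraTneq Tp => ->; rewrite simpleT.2.
  by have [[-> ->]|[-> ->]] := set2_inj p12 eq_uv; rewrite // addbC.
have e'p : e' p.1 p.2 by rewrite /e' /remove_edge Tp.
have -> : connect e' u p.1 = connect e' u p.2.
  by rewrite !(sym_e' u); apply: same_connect => //; exact: connect1.
by rewrite addbACA addbb addbF.
Qed.

End Switching.

(** * Fixing the signs of all edges one by one *)

Section Selection.
Variables (R : realType) (V : finType) (G : rel V) (w : V -> V -> R[i]).
Hypotheses (simpleG : simple_graph G)
  (wC : forall u v, G u v -> w v u = conjc (w u v))
  (w_norm : forall u v, G u v -> w u v * conjc (w u v) = 1).
Implicit Types (L : seq {set V}) (s : {set V} -> bool).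

(** Edges still in [L] have entry 0, since their random signs are accounted for by the operators of
    [mixed L]; the other edges carry the sign chosen by [s]. *)
Definition signed L s : V -> V -> R[i] := fun a b =>
  if G a b && ([set a; b] \notin L) then (-1) ^+ s [set a; b] * w a b else 0.

Lemma hermitian_signed L s : hermitian_fun (signed L s).
Proof.
move=> a b; rewrite /signed simpleG.1 setUC; case: ifP => [/andP[Gab _]|_].
  by rewrite [RHS]rmorphM /= rmorph_sign wC.
by rewrite conjc0.
Qed.

(** Each step replaces the operator of the head edge by an actual entry with the sign given by
    [select_orientation], keeping the same bound [c]. *)
Lemma select_signs c L s : uniq L -> {subset L <= edges G} ->
    (forall t, c < t -> 0 < (real_mixed L (signed L s) setT).[t]) ->
  exists s', forall t, c < t -> 0 < (real_mixed [::] (signed [::] s') setT).[t].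
Proof.
elim: L s => [|e L IHL] s /=; first by move=> _ _ pos; exists s.
move=> /andP[eL uL] LG pos.
have /imsetP[[u v] /= + De] := LG e (mem_head _ _); rewrite inE /= => Guv.
have uv : u != v by apply: contraTneq Guv => ->; rewrite simpleG.2.
have LG' : {subset L <= edges G} by move=> f fL; rewrite LG // inE fL orbT.
have cardL : {in L, forall f : {set V}, #|f| = 2%N}.
  by move=> f /LG'; apply: card_edge.
rewrite {1}De in pos.
have [b bP] := select_orientation uv cardL (@hermitian_signed _ _) (w_norm Guv) pos.
apply: (IHL (fun f => if f == e then b else s f)) => // t /bP.
rewrite (_ : real_mixed _ _ _ = real_mixed L
  (signed L (fun f => if f == e then b else s f)) setT) //.
congr map_poly; apply: eq_mixed => // x y _ _; congr (_%:P).
rewrite /add_edge /signed.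
have [/andP[/eqP-> /eqP->]|nuv] := boolP ((x == u) && (y == v)).
  by rewrite Guv -De mem_head eL eqxx add0r.
have [/andP[/eqP-> /eqP->]|nvu] := boolP ((x == v) && (y == u)).
  by rewrite simpleG.1 Guv setUC -De mem_head eL eqxx add0r -wC.
rewrite addr0; have [Gxy|//] := boolP (G x y).
have xy_e : [set x; y] != e.
  rewrite De; apply: contraTneq isT => /set2_inj[|[xu yv]|[xv yu]].
  - by apply: contraTneq Gxy => ->; rewrite simpleG.2.
  - by rewrite xu yv !eqxx in nuv.
  - by rewrite xv yu !eqxx in nvu.
by rewrite inE (negPf xy_e).
Qed.

End Selection.

Theorem theorem2p8 (R : realType) (V : finType) (G T : rel V)
    (simpleG : simple_graph G) (connG : connected_graph G)
    (treeT : spanning_tree T G) :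
  exists sigma : V -> V -> int,
    partial_orientation G T sigma /\
    lambda_max (hermitian_adj R G T sigma)
      <= root_radius (matching_poly R[i] G).
Proof.
have [[simpleT _ acyclicT] subTG] := treeT.
have [V_gt0 _] := connG.
have symG := simpleG.1; have symT := simpleT.1.
have G_neq u v : G u v -> u != v by apply: contraTneq => ->; rewrite simpleG.2.
(* An arbitrary reference orientation: the weight of a non-tree edge is [i] towards the larger rank
   and [-i] backwards, which makes [w] Hermitian. *)
pose ref (u v : V) := (enum_rank u < enum_rank v)%N.
have refC u v : G u v -> ref v u = ~~ ref u v.
  move=> /G_neq uv; rewrite /ref; case: ltngtP => // /val_inj/enum_rank_inj vu.
  by rewrite vu eqxx in uv.
pose w u v : R[i] := if T u v then 1 else 'i * (-1) ^+ ref v u.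
have wC u v : G u v -> w v u = conjc (w u v).
  move=> Guv; rewrite /w symT; case: ifP => _; first by rewrite conjc1.
  rewrite [RHS]rmorphM /= rmorph_sign (refC v u) 1?symG // signrN mulrN -mulNr.
  by congr (_ * _); apply/eqP; rewrite eq_complex /= oppr0 !eqxx.
have w_norm u v : G u v -> w u v * conjc (w u v) = 1.
  move=> Guv; rewrite /w; case: ifP => _; first by rewrite conjc1 mulr1.
  rewrite [conjc _]rmorphM /= rmorph_sign mulrACA -signr_addb addbb mulr1.
  by apply/eqP; rewrite eq_complex /=; apply/andP; split; apply/eqP; ring.
set c := root_radius _.
have [s' s'P] : exists s', forall t, c < t ->
    0 < (real_mixed [::] (signed G w [::] s') setT).[t].
  (* At the start all edges are averaged, so the matrix is zero and the polynomial is the matching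
     polynomial. *)
  apply: (select_signs simpleG wC w_norm (L := enum (edges G)) (s := fun=> false)).
  - exact: enum_uniq.
  - by move=> e; rewrite mem_enum.
  move=> t; set H := signed _ _ _ _.
  have cardL : {in enum (edges G), forall e : {set V}, #|e| = 2%N}.
    by move=> e; rewrite mem_enum; apply: card_edge.
  have hH : hermitian_fun H by exact: hermitian_signed.
  apply: poly_gt0_above_roots; first exact: real_mixed_lead_gt0.
  move=> x; rewrite -(fmorph_root (real_complex R)) real_mixedE //=.
  have -> : mixed_poly (enum (edges G)) H setT = matching_poly R[i] G.
    rewrite -mixed_matching_poly //; apply: eq_mixed => // a b _ _.
    rewrite /H /signed; case: ifP => // /andP[Gab /negP[]].
    by rewrite mem_enum; apply/imsetP; exists (a, b); rewrite ?inE.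
  have size_mu : (1 < size (matching_poly R[i] G))%N.
    by rewrite size_matching_poly ltnS.
  move/(proj2 (root_radiusP size_mu)); rewrite -/c normc_def lecR /=.
  by rewrite expr0n addr0 sqrtr_sqr; apply: le_trans (ler_norm x).
have [d dP] := acyclic_switching simpleT acyclicT s'.
(* The sign of a non-tree entry after conjugation by the signs [d]. Only the [ref] term changes when
   [u] and [v] are exchanged, hence the antisymmetry of [sigma]. *)
pose sgn u v := d u (+) d v (+) s' [set u; v] (+) ref v u.
pose sigma u v : int := if G u v then (-1) ^+ sgn u v else 0.
have orient : partial_orientation G T sigma.
  move=> u v nTuv; rewrite /sigma symG; have [Gvu|//] := boolP (G v u).
  have sgnC : sgn u v = ~~ sgn v u.
    by rewrite /sgn (refC v u) // setUC [d u (+) _]addbC addbN negbK.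
  split; last by rewrite signr_eq0.
  - by case: (sgn u v).
  - by rewrite sgnC signrN.
exists sigma; split => //; set A := hermitian_adj _ _ _ _.
have hA : A^T = map_mx conjc A by exact: hermitian_adj_hermitian.
have [+ _] := lambda_maxP V_gt0 hA; rewrite eigenvalue_root_char.
(* The diagonal sign matrix [D] is its own inverse, and conjugation by it turns the selected matrix
   into [A]: by the choice of [d] the tree entries become 1. *)
have -> : char_poly A = mixed_poly [::] (signed G w [::] s') setT.
  pose D : 'M[{poly R[i]}]_#|V| := diag_mx (\row_i (-1) ^+ d (enum_val i)).
  have DD : \det D * \det D = 1.
    rewrite det_diag -big_split big1 //= => i _.
    by rewrite mxE -signr_addb addbb.
  have DAD : char_poly_mx A =
      D *m minor_mx (fun a b => (signed G w [::] s' a b)%:P) (fun=> 'X) setT *m D.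
    apply/matrixP => i j; rewrite mul_mx_diag mul_diag_mx !mxE /= !in_setT /=.
    rewrite (inj_eq enum_val_inj) mulr_natl.
    set u := enum_val i; set v := enum_val j.
    rewrite mulrBr mulrBl; congr (_ - _).
      have [eq_ij|_] := eqVneq i j; last by rewrite mulr0n mulr0 mul0r.
      by rewrite /v -eq_ij mulr1n mulrAC -signr_addb addbb expr0 mul1r.
    rewrite mulrAC -signr_addb -(rmorph_sign (@polyC R[i])) -polyCM; congr (_%:P).
    rewrite /signed /w /= andbT; have [Tuv|nTuv] := boolP (T u v).
      by rewrite subTG // mulr1 -signr_addb dP // addbb.
    rewrite /sigma; case: (G u v); last by rewrite mulr0.
    by rewrite rmorph_sign /sgn !signr_addb; ring.
  by rewrite /char_poly DAD !det_mulmx mulrC mulrA DD mul1r.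
rewrite -real_mixedE ?fmorph_root; last exact: hermitian_signed.
rewrite leNgt => root_lambda; apply/negP => /s'P.
by rewrite (rootP root_lambda) ltxx.
Qed.
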